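(* Let $X$ be a compact connected Hausdorff space with a free interval and let $\Phi$ be a minimal action of an abelian semigroup $S$ on $X$. Then $\Phi$ is conjugate to an action of $S$ by rotations on the circle $\mathbb S^1$.
   Context: A free interval in a topological space $X$ is an open subset of $X$ homeomorphic to the open interval $(0,1)$. Semigroups are nonempty and carry the discrete topology. An action of an abelian semigroup $S$ on a space $X$ is a continuous map $\Phi\colon S\times X\to X$ with $\Phi(s,\Phi(t,x))=\Phi(s+t,x)$ for all $s,t\in S$, $x\in X$; its acting maps are $\varphi_s=\Phi(s,\cdot)\colon X\to X$, $s\in S$. The action is minimal if for every $x\in X$ the orbit $\{\varphi_s(x): s\in S\}$ is dense in $X$. Two actions $\Phi,\Psi$ of $S$ on $X,Y$ with acting maps $\varphi_s,\psi_s$ are conjugate if there is a homeomorphism $h\colon X\to Y$ with $h\circ\varphi_s=\psi_s\circ h$ for every $s\in S$. An action on $\mathbb S^1$ is by rotations if each of its acting maps is a rotation of $\mathbb S^1$ (translation by an element of the circle group). *)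

(* Defs.v *)
From HB Require Import structures.
From mathcomp Require Import all_boot all_order all_algebra.
From mathcomp Require Import all_classical all_reals all_analysis.
From mathcomp Require Import complex.

Set Implicit Arguments.
Unset Strict Implicit.
Unset Printing Implicit Defensive.

Import Order.TTheory GRing.Theory Num.Theory.
Import numFieldNormedType.Exports.

Local Open Scope classical_set_scope.
Local Open Scope ring_scope.
Local Open Scope complex_scope.

Definition homeomorphism (X Y : topologicalType) (h : X -> Y) : Prop :=
  continuous h /\
  exists g : Y -> X, [/\ continuous g, cancel h g & cancel g h].

Definition homeomorphic (X Y : topologicalType) : Prop :=
  exists h : X -> Y, homeomorphism h.

(* A set coerces to the subtype of its elements ([set_type]), which carries
   the subspace topology; this is what [homeomorphic U _] and [circle] use. *)
Definition free_interval (R : realType) (X : topologicalType) (U : set X) :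
    Prop :=
  open U /\ homeomorphic U (`]0, 1[%classic : set R).

(* [addSemigroupType] is commutative and does not assume a neutral element
   (nor that the carrier is nonempty); hence no axiom on the action of 0. *)
Record action (S : addSemigroupType) (X : topologicalType) := Action {
  action_map :> discrete_topology S * X -> X ;
  action_continuous : continuous action_map ;
  action_add : forall (s t : S) (x : X),
    action_map (s, action_map (t, x)) = action_map (s + t, x)
}.

Section Actions.
Variables (S : addSemigroupType).

Definition acting_map (X : topologicalType) (Phi : action S X) (s : S) :
    X -> X :=
  fun x => Phi (s, x).

Definition action_orbit (X : topologicalType) (Phi : action S X) (x : X) : set X :=
  range (fun s : S => acting_map Phi s x).

Definition minimal_action (X : topologicalType) (Phi : action S X) : Prop :=
  forall x : X, dense (action_orbit Phi x).

Definition conjugate_actions (X Y : topologicalType) (Phi : action S X)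
    (Psi : action S Y) : Prop :=
  exists2 h : X -> Y, homeomorphism h &
    forall s : S, h \o acting_map Phi s = acting_map Psi s \o h.

End Actions.

(* [R[i]^o] is [R[i]] with its modulus topology ([R[i]] itself carries none). *)
Definition circle (R : realType) : topologicalType :=
  set_type [set z : R[i]^o | `|z| = 1 :> R[i]].

Definition is_rotation (R : realType) (f : circle R -> circle R) : Prop :=
  exists c : circle R, forall z : circle R, \val (f z) = \val c * \val z.

Definition by_rotations (R : realType) (S : addSemigroupType)
    (Psi : action S (circle R)) : Prop :=
  forall s : S, is_rotation (acting_map Psi s).

(* Main.v *)
Require Import Defs.
From HB Require Import structures.
From mathcomp Require Import all_boot all_order all_algebra.
From mathcomp Require Import all_classical all_reals all_analysis.
From mathcomp Require Import finmap complex zify lra.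

(* Two continuous maps that commute with a minimal action and agree at one
   point are equal.  Hence, along an interval contained in the free interval U,
   the graph of a map commuting with the action stays trapped between the graphs
   of two acting maps, which makes the commuting maps evenly continuous on U.
   This makes suitable pointwise limits of acting maps continuous, so the
   commuting maps act simply transitively on X and turn X into a compact
   connected abelian topological group on which the acting maps are
   translations.  Near 0 this group is ordered like an interval and its addition
   is strictly monotone; repeated halving of a small positive element then gives
   a continuous homomorphism from R onto the group.  Its kernel is infinite
   cyclic, so the group is a circle. *)

Set Implicit Arguments.
Unset Strict Implicit.
Unset Printing Implicit Defensive.

Import Order.TTheory GRing.Theory Num.Theory.
Import numFieldNormedType.Exports.

Local Open Scope classical_set_scope.
Local Open Scope ring_scope.
Local Open Scope complex_scope.

(** * Charts of a free interval *)

Lemma near_continuous_lt (R : realType) (X : topologicalType) (f g : X -> R) x :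
  {for x, continuous f} -> {for x, continuous g} -> f x < g x ->
  \forall y \near x, f y < g y.
Proof.
move=> cf cg fg.
have c : (g y - f y) @[y --> x] --> g x - f x by exact: cvgB.
have : 0 < g x - f x by rewrite subr_gt0.
by move=> /(cvgr_gt _ c); apply: filterS => y; rewrite subr_gt0.
Qed.

Lemma continuous_eq_dense (X : topologicalType) (A : set X) (f g : X -> X) :
  hausdorff_space X -> dense A -> continuous f -> continuous g ->
  {in A, f =1 g} -> f =1 g.
Proof.
move=> hX dA cf cg fg x; apply: hX => V W Vf Wg.
have : nbhs x (f @^-1` V `&` g @^-1` W).
  by apply: filterI; [exact: cf|exact: cg].
rewrite nbhsE => -[V0 [oV0 V0x] V0VW].
have [y [/V0VW[/= Vy Wy] Ay]] := dA V0 (ex_intro _ x V0x) oV0.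
by exists (f y); split => //; rewrite fg //; exact: mem_set.
Qed.

(** [c] and [l] are total functions, mutually inverse between ]a, b[ and [U], so that real analysis
    applies without subtypes. The endpoints are parameters so that a chosen point can later receive
    coordinate 0. *)
Record chart (R : realType) (X : topologicalType) (U : set X) (a b : R)
    (c : R -> X) (l : X -> R) : Prop := Chart {
  chart_open : open U ;
  chartP : forall r, a < r < b -> U (c r) ;
  chartVP : forall x, U x -> a < l x < b ;
  chartK : forall r, a < r < b -> l (c r) = r ;
  chartVK : forall x, U x -> c (l x) = x ;
  chart_cont : forall r, a < r < b -> {for r, continuous c} ;
  chartV_cont : forall x, U x -> {for x, continuous l} }.

Section Chart.
Context (R : realType) (X : topologicalType) (U : set X) (a b : R).
Context (c : R -> X) (l : X -> R) (ch : chart U a b c l).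

Lemma chart_itv_cont (A : set R) :
  A `<=` [set r | a < r < b] -> {within A, continuous c}.
Proof.
move=> Aab; apply: continuous_in_subspaceT => r /set_mem /Aab /=.
exact: chart_cont ch _.
Qed.

Lemma chart_nbhs x : U x -> nbhs x U.
Proof. by move=> Ux; apply: open_nbhs_nbhs; split => //; exact: chart_open ch. Qed.

Lemma open_chart_itv p q : a <= p -> q <= b ->
  open [set x | U x /\ p < l x < q].
Proof.
move=> ap qb; rewrite openE => x [Ux /andP[px xq]].
rewrite /interior; near=> y; split; first by near: y; exact: chart_nbhs.
apply/andP; split; near: y.
- exact: cvgr_gt _ (chartV_cont ch Ux) _ px.
- exact: cvgr_lt _ (chartV_cont ch Ux) _ xq.
Unshelve. all: by end_near. Qed.

Lemma image_chart_itv p q : a <= p -> q <= b ->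
  c @` [set r | p < r < q] = [set x | U x /\ p < l x < q].
Proof.
move=> ap qb; apply/seteqP; split => [_ [r /andP[pr rq] <-]|x [Ux pxq]]; last first.
  by exists (l x) => //; exact: chartVK ch _ Ux.
have arb : a < r < b by rewrite (le_lt_trans ap pr) (lt_le_trans rq qb).
by split; [exact: chartP ch _ arb|rewrite (chartK ch arb) pr rq].
Qed.

Lemma connected_chart_itv p q : a <= p -> q <= b ->
  connected [set x | U x /\ p < l x < q].
Proof.
move=> ap qb; rewrite -image_chart_itv //.
apply: connected_continuous_connected.
  apply/connected_intervalP => x y /andP[px _] /andP[_ yq] z /andP[xz zy] /=.
  by rewrite (lt_le_trans px xz) (le_lt_trans zy yq).
apply: chart_itv_cont => r /= /andP[pr rq].
by rewrite (le_lt_trans ap pr) (lt_le_trans rq qb).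
Qed.

(** The band is the image under [c] of the compact segment [p, q], which the strict inequalities
    keep inside the domain of the chart. *)
Lemma closed_chart_itv p q : hausdorff_space X -> a < p -> q < b ->
  closed [set x | U x /\ p <= l x <= q].
Proof.
move=> hX ap qb; apply: compact_closed => //.
suff -> : [set x | U x /\ p <= l x <= q] = c @` `[p, q].
  apply: continuous_compact; last exact: segment_compact.
  apply: chart_itv_cont => r /=; rewrite in_itv /= => /andP[pr rq].
  by rewrite (lt_le_trans ap pr) (le_lt_trans rq qb).
apply/seteqP; split => [x [Ux pxq]|y [r /=]].
  by exists (l x); rewrite /= ?in_itv //=; exact: chartVK ch _ Ux.
rewrite in_itv /= => /andP[pr rq] <-.
have arb : a < r < b by rewrite (lt_le_trans ap pr) (le_lt_trans rq qb).
by split; [exact: chartP ch _ arb|rewrite (chartK ch arb) pr rq].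
Qed.

(* Graphs of coincidence-free maps cannot cross, so [g] is trapped between
   [s1] and [s2] along a connected set. *)
Lemma squeezed_on_connected (A : set X) (u : X) (s1 s2 g : X -> X) p q :
  hausdorff_space X -> connected A -> open A -> A u -> a < p -> q < b ->
  continuous s1 -> continuous s2 -> continuous g ->
  (forall x, A x -> [/\ U (s1 x), U (s2 x), p < l (s1 x) & l (s2 x) < q]) ->
  (forall x, s1 x <> g x) -> (forall x, s2 x <> g x) ->
  U (g u) -> l (s1 u) < l (g u) < l (s2 u) ->
  forall x, A x -> U (g x) /\ l (s1 x) < l (g x) < l (s2 x).
Proof.
move=> hX cA oA Au ap qb cs1 cs2 cg As s1g s2g Ugu lgu.
have cl (f : X -> X) x : continuous f -> U (f x) -> {for x, continuous (l \o f)}.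
  by move=> cf Ufx; apply: continuous_comp; [exact: cf|exact: chartV_cont ch _ Ufx].
(* The trapped points will form a nonempty clopen subset of the connected set [A]. *)
pose B := [set x | A x /\ U (g x) /\ l (s1 x) < l (g x) < l (s2 x)].
suff BA : B = A by move=> x; rewrite -{1}BA => -[].
apply: cA; first by exists u.
- exists B; last by apply/seteqP; split => x; [move=> []|move=> [_ []]].
  rewrite openE => x [Ax [Ugx /andP[l1 l2]]].
  have [Us1 Us2 _ _] := As _ Ax.
  rewrite /interior; near=> y; split; first by near: y; exact: open_nbhs_nbhs.
  split; first by near: y; apply: cg; exact: chart_nbhs.
  apply/andP; split; near: y.
  + by apply: (@near_continuous_lt _ _ (l \o s1) (l \o g)) => //; exact: cl.
  + by apply: (@near_continuous_lt _ _ (l \o g) (l \o s2)) => //; exact: cl.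
- exists (~` (A `&` ~` B)); last first.
    apply/seteqP; split => x; first by move=> Bx; split; [case: Bx|case].
    by move=> [Ax nAB]; apply: contrapT => nB; exact: nAB.
  apply: open_closedC; rewrite openE => x [Ax nBx].
  have nA : nbhs x A by exact: open_nbhs_nbhs.
  have [Us1 Us2 l1 l2] := As _ Ax.
  (* If [g x] lies in the band, the absence of coincidences makes a failed inequality strictly
     reversed, and this persists nearby. If not, [g] avoids the closed band near [x], whereas
     trapped values lie in it. *)
  have [[Ugx /andP[pg gq]]|npq] := pselect (U (g x) /\ p <= l (g x) <= q).
  + have [lt1|gt1|eq1] := ltgtP (l (s1 x)) (l (g x)); last first.
    * by case: (s1g x); rewrite -(chartVK ch Us1) eq1 (chartVK ch Ugx).
    * have := near_continuous_lt (cl _ _ cg Ugx) (cl _ _ cs1 Us1) gt1.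
      rewrite /interior; apply: filterS2 nA => y Ay ly; split => // -[_ [_]].
      by case/andP => /ltW; rewrite leNgt ly.
    have [lt2|gt2|eq2] := ltgtP (l (g x)) (l (s2 x)); last first.
    * by case: (s2g x); rewrite -(chartVK ch Us2) -eq2 (chartVK ch Ugx).
    * have := near_continuous_lt (cl _ _ cs2 Us2) (cl _ _ cg Ugx) gt2.
      rewrite /interior; apply: filterS2 nA => y Ay ly; split => // -[_ [_]].
      by case/andP => _ /ltW; rewrite leNgt ly.
    by case: nBx; rewrite /B /= lt1 lt2.
  + have : nbhs (g x) (~` [set z | U z /\ p <= l z <= q]).
      apply: open_nbhs_nbhs; split => //; apply: closed_openC.
      exact: closed_chart_itv.
    move=> /cg; rewrite /nbhs /= => npq'.
    rewrite /interior; apply: filterS2 nA npq' => y Ay npqy; split => // -[_ [Ugy]].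
    move=> /andP[m1 m2]; apply: npqy; split => //.
    have [_ _ pl lq] := As _ Ay.
    by rewrite (ltW (lt_trans pl m1)) (ltW (lt_trans m2 lq)).
Unshelve. all: by end_near. Qed.

End Chart.

(** * Maps commuting with a minimal family *)

Lemma nbhs_itv_inside (R : realType) (a b x : R) (P : set R) :
  a < x < b -> nbhs x P ->
  exists p q, [/\ a < p < x, x < q < b & forall r, p < r < q -> P r].
Proof.
move=> /andP[ax xb] /nbhs_ballP[e /= e0 eP].
(* The midpoints keep [p] and [q] strictly inside ]a, b[, as closedness of the bands requires. *)
exists (Num.max ((a + x) / 2) (x - e)), (Num.min ((x + b) / 2) (x + e)).
split.
- rewrite lt_max gt_max; apply/andP.
  by split; [apply/orP; left|apply/andP; split]; lra.
- rewrite gt_min lt_min; apply/andP.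
  by split; [apply/andP; split|apply/orP; left]; lra.
- move=> r; rewrite gt_max lt_min => /andP[/andP[_ xer] /andP[_ rxe]].
  by apply: eP; rewrite /ball /= ltr_norml; apply/andP; split; lra.
Qed.

(** An ultrafilter extending the image filter converges by compactness. Since [G] already decides
    every preimage, the image filter has the same limit. *)
Lemma ultra_compact_cvg (T : Type) (X : topologicalType) (G : set_system T)
    (f : T -> X) :
  compact [set: X] -> UltraFilter G -> exists x : X, f t @[t --> G] --> x.
Proof.
move=> compactX GU.
have [H [HU GH]] := ultraFilterLemma (fmap_proper_filter f (F := G) _).
have HT : H setT by exact: filterT.
move: compactX; rewrite compact_ultra => /(_ H HU HT)[w [_ Hw]].
exists w => N /Hw HN /=; rewrite /nbhs /=.
have [//|GC] := in_ultra_setVsetC (f @^-1` N) GU.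
have HC : H (~` N) by exact: GH.
by have /filter_ex[v []] : H (N `&` ~` N) by exact: filterI.
Qed.

Section CommutingMaps.
Context (R : realType) (X : topologicalType).
Hypotheses (compactX : compact [set: X]) (hausdorffX : hausdorff_space X).
Context (S : choiceType) (phi : S -> X -> X).
Hypotheses (phi_cont : forall s, continuous (phi s))
  (phiC : forall s t x, phi s (phi t x) = phi t (phi s x))
  (phi_dense : forall x, dense (range (phi^~ x))).
Context (U : set X) (a b : R) (c : R -> X) (l : X -> R).
Hypotheses (ch : chart U a b c l) (U_neq0 : U !=set0).

Definition commuting (g : X -> X) :=
  continuous g /\ forall s x, g (phi s x) = phi s (g x).

Lemma commuting_phi s : commuting (phi s).
Proof. by split. Qed.

Lemma commuting_id : commuting id.
Proof. by split => // x. Qed.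

Lemma commuting_comp f g : commuting f -> commuting g -> commuting (f \o g).
Proof.
move=> [cf fC] [cg gC]; split => [x|s x /=]; last by rewrite gC fC.
by apply: continuous_comp; [exact: cg|exact: cf].
Qed.

(** Agreement at [x] spreads along the orbit of [x], which is dense. *)
Lemma commuting_eq f g x : commuting f -> commuting g -> f x = g x -> f =1 g.
Proof.
move=> [cf fC] [cg gC] fgx.
apply: (continuous_eq_dense hausdorffX (phi_dense x) cf cg) => y /set_mem[s _ <-].
by rewrite fC gC fgx.
Qed.

(** The neighbourhoods serve all [g] at once. Minimality gives acting maps sending [u] slightly
    below and slightly above [v]. A commuting map whose value at [u] lies strictly between theirs
    meets neither graph, so it stays trapped near [u]. *)
Lemma even_continuity u v N : U u -> U v -> nbhs v N ->
  exists A B, [/\ nbhs u A, nbhs v B &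
    forall g, commuting g -> B (g u) -> forall x, A x -> N (g x)].
Proof.
move=> Uu Uv Nv.
have alv := chartVP ch Uv.
have Nc : nbhs (l v) (c @^-1` N).
  by apply: (chart_cont ch alv); rewrite (chartVK ch Uv).
have [p [q [/andP[ap pv] /andP[vq qb] pqN]]] := nbhs_itv_inside alv Nc.
have [/andP[av vb]] := (alv).
have dense_itv x p' q' : a <= p' -> p' < q' -> q' <= b ->
    exists s, U (phi s x) /\ p' < l (phi s x) < q'.
  move=> ap' pq' qb'.
  have [|y [[Uy ly] [s _ sy]]] :=
      @phi_dense x _ _ (open_chart_itv ch ap' qb').
    have arb : a < (p' + q') / 2 < b by lra.
    exists (c ((p' + q') / 2)); split; first exact: chartP ch _ arb.
    by rewrite (chartK ch arb); lra.
  by exists s; rewrite sy.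
have [s1 [Us1 /andP[ps1 s1v]]] := dense_itv u p (l v) (ltW ap) pv (ltW vb).
have [s2 [Us2 /andP[vs2 s2q]]] := dense_itv u (l v) q (ltW av) vq (ltW qb).
have cl s : U (phi s u) -> {for u, continuous (l \o phi s)}.
  by move=> Us; apply: continuous_comp; [exact: phi_cont|exact: chartV_cont ch _ Us].
(* Where both bounding maps stay in the chart, one above [p] and the other below [q], trapped values
   lie in ]p, q[ and hence in [N]. *)
pose P := [set y |
  [/\ U (phi s1 y), U (phi s2 y), p < l (phi s1 y) & l (phi s2 y) < q]].
have Pu : nbhs u P.
  near=> y; split; near: y.
  - by apply: phi_cont; exact: chart_nbhs ch _ Us1.
  - by apply: phi_cont; exact: chart_nbhs ch _ Us2.
  - exact: cvgr_gt _ (cl _ Us1) _ ps1.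
  - exact: cvgr_lt _ (cl _ Us2) _ s2q.
have alu := chartVP ch Uu.
have Pc : nbhs (l u) (c @^-1` P).
  by apply: (chart_cont ch alu); rewrite (chartVK ch Uu).
have [p' [q' [/andP[ap' pu] /andP[uq qb'] pqP]]] := nbhs_itv_inside alu Pc.
pose A := [set x | U x /\ p' < l x < q'].
have oA : open A by apply: (open_chart_itv ch); exact: ltW.
have Au : A u by split => //; rewrite pu uq.
exists A, [set x | U x /\ l (phi s1 u) < l x < l (phi s2 u)]; split.
- exact: open_nbhs_nbhs.
- apply: open_nbhs_nbhs; split; last by split; rewrite // s1v vs2.
  apply: (open_chart_itv ch); first by rewrite ltW// (lt_trans ap ps1).
  by rewrite ltW// (lt_trans s2q qb).
move=> g [cg gC] [Ugu sgs] x Ax.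
have AP y : A y -> P y by move=> [Uy /pqP] /=; rewrite (chartVK ch Uy).
have [| |Ugx /andP[s1x s2x]] := squeezed_on_connected ch hausdorffX
  (connected_chart_itv ch (ltW ap') (ltW qb')) oA Au ap qb (@phi_cont s1)
  (@phi_cont s2) cg AP _ _ Ugu sgs Ax.
(* One coincidence would give equality everywhere, in particular at [u], where the inequality is
   strict. *)
- move=> y /(commuting_eq (commuting_phi s1) (conj cg gC)) e.
  by move: sgs; rewrite e ltxx.
- move=> y /(commuting_eq (commuting_phi s2) (conj cg gC)) e.
  by move: sgs; rewrite e ltxx andbF.
have [_ _ px xq] := AP _ Ax.
rewrite -(chartVK ch Ugx); apply: pqN.
by rewrite (lt_trans px s1x) (lt_trans s2x xq).
Unshelve. all: by end_near. Qed.

(** Commuting with all commuting maps, and not only with the [phi s], is what will make the group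
    law on [X] commutative. *)
Definition central (g : X -> X) :=
  commuting g /\ forall f, commuting f -> g \o f =1 f \o g.

Lemma central_phi s : central (phi s).
Proof. by split => [|f [_ fC] x /=]; [exact: commuting_phi|rewrite fC]. Qed.

Lemma central_comp f g : central f -> central g -> central (f \o g).
Proof.
move=> [cf fC] [cg gC]; split => [|h ch' x /=]; first exact: commuting_comp.
by have /= -> := gC h ch' x; have /= -> := fC h ch' (g x).
Qed.

(** By minimality and compactness, finitely many preimages of [U] under the [phi s] cover [X].
    [theta] is the composite of these [phi s]; since they commute, any of them can be applied
    first. *)
Lemma cover_multiple : exists2 theta, central theta &
  forall x, exists s psi, [/\ U (phi s x), central psi & theta =1 psi \o phi s].
Proof.
have multiple (ss : seq S) : exists2 theta, central theta &
    forall s, s \in ss -> exists2 psi, central psi & theta =1 psi \o phi s.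
  elim: ss => [|t ss [theta ct thetaP]].
    by exists id => //; split => //; exact: commuting_id.
  exists (theta \o phi t); first by apply: central_comp => //; exact: central_phi.
  move=> s; rewrite inE => /predU1P[->|/thetaP[psi cpsi psiE]]; first by exists theta.
  exists (psi \o phi t); first by apply: central_comp => //; exact: central_phi.
  by move=> x /=; rewrite psiE /= phiC.
have [x0 Ux0] := U_neq0.
pose X' : ptopologicalType := HB.pack (X : Type) X (isPointed.Build X x0).
have : @cover_compact X' setT by rewrite -(@compact_cover X'); exact: compactX.
move=> /(_ S setT (fun s => phi s @^-1` U)) [s _||D _ cov].
- by apply: open_comp => [y _|]; [exact: phi_cont|exact: chart_open ch].
- move=> x _; have [y [Uy [s _ sx]]] := @phi_dense x _ U_neq0 (chart_open ch).
  by exists s => //; rewrite /preimage /= sx.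
have [theta ct thetaP] := multiple D.
exists theta => // x; have [s Ds Us] := cov x I.
by have [psi cpsi psiE] := thetaP s Ds; exists s, psi.
Qed.

(* Precomposing a pointwise limit of acting maps with a common multiple of
   finitely many [phi s] makes it continuous everywhere: each point is moved
   into [U], and so is its image, where [even_continuity] applies. *)
Lemma central_transitive x y : exists2 g, central g & g x = y.
Proof.
have [theta ct thetaP] := cover_multiple.
(* The filter of those [s] that bring [theta (theta x)] close to [y], proper because orbits are
   dense. One copy of [theta] will move the point into [U], the other its image. *)
pose F := filter_from (nbhs y) (fun N => [set s | N (phi s (theta (theta x)))]).
have FF : ProperFilter F.
  apply: filter_from_proper.
    apply: filter_from_filter; first by exists setT; exact: filterT.
    by move=> N M yN yM; exists (N `&` M) => //; exact: filterI.
  move=> N; rewrite nbhsE => -[V [oV Vy] VN].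
  have [w [Vw [s _ sw]]] := @phi_dense (theta (theta x)) _ (ex_intro _ y Vy) oV.
  by exists s; rewrite /= sw; exact: VN.
have [G [GU FG]] := ultraFilterLemma FF.
(* [g0] is a pointwise limit of acting maps. Its continuity is not known, but it commutes with every
   commuting map. *)
have [g0 g0P] := choice (fun z => ultra_compact_cvg (phi^~ z) compactX GU).
have g0C f : commuting f -> forall z, g0 (f z) = f (g0 z).
  move=> [cf fC] z; apply: (cvg_unique hausdorffX (g0P (f z))).
  have : f (phi s z) @[s --> G] --> f (g0 z).
    by apply: (cvg_comp (phi^~ z) f); [exact: g0P|exact: cf].
  by under eq_fun do rewrite fC.
exists (fun z => g0 (theta (theta z))); last first.
  apply: (cvg_unique hausdorffX (g0P (theta (theta x)))) => N yN.
  by apply: FG; exists N.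
split; last first.
  move=> f cf z /=; have tf w : theta (f w) = f (theta w) by exact: ct.2 f cf w.
  by rewrite !tf g0C.
split => [z|s z]; last by rewrite !ct.1.2 g0C //; exact: commuting_phi.
have [r [psi [Ur [cpsi psiC] psiE]]] := thetaP z.
have [r' [psi' [Ur' [cpsi' _] psiE']]] := thetaP (g0 (phi r z)).
(* [phi r] sends [z] into [U] and [phi r'] sends [g0 (phi r z)] into [U]. The cofactors [psi] and
   [psi'] are continuous and pass outside the limit. *)
have -> : (fun z => g0 (theta (theta z))) =
    (psi \o psi') \o (fun w => g0 (phi r' (phi r w))).
  apply/funext => w /=; rewrite -!g0C //; congr g0.
  have /= psi'C := psiC _ cpsi' w.
  by rewrite psiE' /= psiE /= !cpsi.2 !cpsi'.2 !cpsi.2 psi'C.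
have cg1 : {for phi r z, continuous (fun w => g0 (phi r' w))}.
  move=> N; rewrite g0C; last exact: commuting_phi.
  (* Regularity is used because a limit of points of [M] is only known to lie in the closure of
     [M]. *)
  move=> N0; have [M vM MN] : filter_from (nbhs (phi r' (g0 (phi r z)))) closure N.
    exact: (compact_regular hausdorffX compactX filterT).
  have [A [B [uA vB AB]]] := even_continuity Ur Ur' vM.
  apply: filterS uA => w Aw; apply: MN.
  rewrite /= g0C; last exact: commuting_phi.
  have cvg1 u : phi r' (phi s u) @[s --> G] --> phi r' (g0 u).
    by apply: (cvg_comp (phi^~ u) (phi r')); [exact: g0P|exact: phi_cont].
  apply: (closed_cvg _ (@closed_closure _ M)) (cvg1 w).
  have := cvg1 (phi r z) B vB; rewrite /nbhs /=; apply: filterS => s Bs.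
  apply: subset_closure; apply: (AB (phi r' \o phi s)) => //.
  by apply: commuting_comp; exact: commuting_phi.
apply: continuous_comp; last exact: (commuting_comp cpsi cpsi').1.
exact: (continuous_comp (@phi_cont r z) cg1).
Qed.

End CommutingMaps.

(** * The local order of a group with a free interval *)

Section LocalOrder.
Context (R : realType) (G : topologicalZmodType).
Hypotheses (compactG : compact [set: G]) (hausdorffG : hausdorff_space G).
Context (U : set G) (a b : R) (c : R -> G) (l : G -> R).
Hypotheses (ch : chart U a b c l) (a0 : a < 0) (b0 : 0 < b) (c0 : c 0 = 0).

Lemma chart_zero : U 0 /\ l 0 = 0.
Proof.
have ab : a < 0 < b by rewrite a0 b0.
by rewrite -{1 2}c0; split; [exact: chartP ch _ ab|rewrite (chartK ch ab)].
Qed.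

(** Continuity of addition at (0, 0) fixes a scale [d] below which sums can be read in the chart. *)
Lemma addable_box : exists d, [/\ 0 < d, a < - d, d < b &
  forall r t, `|r| < d -> `|t| < d -> U (c r + c t)].
Proof.
have ab : a < 0 < b by rewrite a0 b0.
have : nbhs (0 : G, 0 : G) [set x : G * G | U (x.1 + x.2)].
  by apply: add_continuous; apply: (chart_nbhs ch); rewrite /= addr0; case: chart_zero.
case=> -[A B] /= [A0 B0 AB].
have cA : nbhs (0 : R) (c @^-1` (A `&` B)).
  by apply: (chart_cont ch ab); rewrite c0; exact: filterI.
have [p [q [/andP[ap p0] /andP[q0 qb] pqAB]]] := nbhs_itv_inside ab cA.
have d0 : 0 < Num.min (- p) q by rewrite lt_min oppr_gt0 p0.
exists (Num.min (- p) q); split => //.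
- by rewrite ltrNr gt_min ltrN2 ap.
- by rewrite gt_min qb orbT.
- move=> r t; rewrite !lt_min !ltr_norml.
  move=> /andP[/andP[r1 r2] /andP[r3 r4]] /andP[/andP[t1 t2] /andP[t3 t4]].
  have [|Ar _] := pqAB r; first by lra.
  have [|_ Bt] := pqAB t; first by lra.
  exact: (AB (c r, c t)).
Qed.

Context (d : R).
Hypotheses (d0 : 0 < d) (ad : a < - d) (db : d < b)
  (addU : forall r t, `|r| < d -> `|t| < d -> U (c r + c t)).

Lemma box_in r : `|r| < d -> a < r < b.
Proof.
by rewrite ltr_norml => /andP[dr rd]; rewrite (lt_trans ad dr) (lt_trans rd db).
Qed.

Definition small_nneg (x : G) := U x /\ 0 <= l x < d.

Lemma small_nneg_norm x : small_nneg x -> `|l x| < d.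
Proof. by move=> [_ /andP[x0 xd]]; rewrite ger0_norm. Qed.

Lemma small_nneg_add x y : small_nneg x -> small_nneg y -> U (x + y).
Proof.
move=> Px Py; have := addU (small_nneg_norm Px) (small_nneg_norm Py).
by rewrite !(chartVK ch) //; [case: Py|case: Px].
Qed.

Lemma small_nneg0 : small_nneg 0.
Proof. by have [U0 l0] := chart_zero; split; rewrite // l0 lexx. Qed.

Lemma chart_add_cont (f g : R -> R) x :
  {for x, continuous f} -> {for x, continuous g} -> `|f x| < d -> `|g x| < d ->
  {for x, continuous (fun r => l (c (f r) + c (g r)))}.
Proof.
move=> cf cg fd gd.
apply: (continuous_comp (f := fun r => c (f r) + c (g r))); last first.
  by apply: (chartV_cont ch); exact: addU.
apply: (continuous_comp (f := fun r => (c (f r), c (g r)))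
  (g := fun z : G * G => z.1 + z.2)); last exact: add_continuous.
apply: cvg_pair.
  by apply: (continuous_comp cf); apply: (chart_cont ch); exact: box_in.
by apply: (continuous_comp cg); apply: (chart_cont ch); exact: box_in.
Qed.

Lemma small_nneg_itv x r : small_nneg x -> 0 <= r <= l x -> `|r| < d.
Proof.
by move=> [_ /andP[x0 xd]] /andP[r0 rx]; rewrite ger0_norm // (le_lt_trans rx xd).
Qed.

(** Slide the first summand from 0 to [x] along the chart. If the order of the two sums changed,
    they would coincide somewhere by the intermediate value theorem, and cancellation would give [y]
    = [z]. *)
Lemma small_nneg_ltD x y z : small_nneg x -> small_nneg y -> small_nneg z ->
  l y < l z -> l (x + y) < l (x + z).
Proof.
move=> Px Py Pz yz; rewrite ltNge; apply/negP => zy.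
pose f r := l (c r + z) - l (c r + y).
have x0 : 0 <= l x by case: Px => _ /andP[].
have cl t : small_nneg t -> c (l t) = t by move=> [Ut _]; exact: chartVK ch _ Ut.
have [_ l0] := chart_zero.
have cf : {within `[0, l x], continuous f}.
  apply: continuous_in_subspaceT => r /set_mem /=; rewrite in_itv /= => rx.
  have rd := small_nneg_itv Px rx.
  apply: cvgB.
    have := @chart_add_cont id (fun=> l z) r _ _ rd (small_nneg_norm Pz).
    by rewrite cl //; apply => //; exact: cvg_cst.
  have := @chart_add_cont id (fun=> l y) r _ _ rd (small_nneg_norm Py).
  by rewrite cl //; apply => //; exact: cvg_cst.
have [|r rx fr0] := IVT x0 cf (v := 0).
  rewrite /f c0 !add0r cl // ge_min le_max !subr_ge0 !subr_le0 zy (ltW yz).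
  by rewrite orbT.
have rd := small_nneg_itv Px rx.
have Ur t : small_nneg t -> U (c r + t).
  by move=> Pt; have := addU rd (small_nneg_norm Pt); rewrite cl.
move: fr0 => /eqP; rewrite subr_eq0 => /eqP /(congr1 c).
rewrite !(chartVK ch) => [/addrI e||]; [|exact: Ur..].
by move: yz; rewrite e ltxx.
Qed.

(** The coordinate of [c r + c r] is 0 at [r] = 0 and exceeds [l y] at [r] = [l y], so it takes the
    value [l y] in between. *)
Lemma small_nneg_half y : small_nneg y -> 0 < l y ->
  exists x, [/\ small_nneg x, 0 < l x < l y & x + x = y].
Proof.
move=> Py y0; have [_ l0] := chart_zero.
have lyy : l y < l (y + y).
  by rewrite -{1}(addr0 y); apply: small_nneg_ltD => //; [exact: small_nneg0|rewrite l0].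
have cf : {within `[0, l y], continuous (fun r => l (c r + c r))}.
  apply: continuous_in_subspaceT => r /set_mem /=; rewrite in_itv /= => ry.
  have rd := small_nneg_itv Py ry.
  exact: (@chart_add_cont id id).
have Uy : U y by case: Py.
have [|r] := IVT (ltW y0) cf (v := l y).
  by rewrite c0 addr0 l0 (chartVK ch Uy) ge_min le_max (ltW y0) (ltW lyy) orbT.
rewrite in_itv /= => ry rE.
have rd := small_nneg_itv Py ry.
have lcr := chartK ch (box_in rd); have Ucr := chartP ch (box_in rd).
have r0 : r != 0.
  by apply: contraPneq rE => ->; rewrite c0 addr0 l0 => e; move: y0; rewrite -e ltxx.
have ry' : r != l y.
  by apply: contraPneq rE => ->; rewrite (chartVK ch Uy) => e; move: lyy; rewrite e ltxx.
have /andP[r0' ry''] := ry.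
exists (c r); split.
- by split; rewrite // lcr r0' -(ger0_norm r0').
- by rewrite lcr !lt_neqAle eq_sym r0 r0' ry' ry''.
- by rewrite -(chartVK ch Uy) -rE (chartVK ch) //; exact: addU.
Qed.


(** * Halving sequences and the one-parameter subgroup *)

(** [e k] plays the role of 2^-k in the group. *)
Definition halving (e : nat -> G) := forall k,
  [/\ small_nneg (e k), 0 < l (e k), l (e k.+1) < l (e k) & e k.+1 + e k.+1 = e k].

Lemma halving_exists : exists e, halving e.
Proof.
have halfP y : exists x, small_nneg y /\ 0 < l y ->
    [/\ small_nneg x, 0 < l x < l y & x + x = y].
  have [[Py y0]|n] := pselect (small_nneg y /\ 0 < l y); last by exists 0.
  by have [x xP] := small_nneg_half Py y0; exists x.
have [half hP] := choice halfP.
pose e k := iter k half (c (d / 2)).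
have eP k : small_nneg (e k) /\ 0 < l (e k).
  elim: k => [|k /hP[? /andP[]]] //=.
  have d2 : 0 < d / 2 by exact: divr_gt0.
  have dd2 : `|d / 2| < d by rewrite gtr0_norm // ltr_pdivrMr // ltr_pMr ?ltr1n.
  have H := chartK ch (box_in dd2); split; rewrite ?H //.
  split; first exact: chartP ch _ (box_in dd2).
  by rewrite H ltW //= -(gtr0_norm d2).
exists e => k; have [ek0 ek1] := eP k; have [_ /andP[_ lt] ee] := hP _ (eP k).
by split.
Qed.

Context (e : nat -> G) (eP : halving e).

Let e_small k : small_nneg (e k). Proof. by case: (eP k). Qed.
Let e_gt0 k : 0 < l (e k). Proof. by case: (eP k). Qed.
Let e_lt k : l (e k.+1) < l (e k). Proof. by case: (eP k). Qed.
Let e_double k : e k.+1 + e k.+1 = e k. Proof. by case: (eP k). Qed.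

(** The decreasing coordinates tend to some [m] >= 0. Doubling shifts the sequence back by one, so
    [c m + c m] also has coordinate [m]; strict monotonicity forbids this when [m] > 0. *)
Lemma halving_cvg0 : e k @[k --> \oo] --> (0 : G).
Proof.
have [U0 l0] := chart_zero.
have decr : nonincreasing_seq (l \o e).
  by apply/nonincreasing_seqP => k; exact: ltW (e_lt k).
have lbd : has_lbound (range (l \o e)).
  by exists 0 => _ [k _ <-]; exact: ltW (e_gt0 k).
have cv := nonincreasing_is_cvgn decr lbd.
set m := limn (l \o e) in cv.
have m0 : 0 <= m by apply: limr_ge => //; near=> k; exact: ltW (e_gt0 k).
have md : `|m| < d.
  rewrite ger0_norm //; apply: (le_lt_trans (nonincreasing_cvgn_ge decr cv 0%N)).
  by case: (e_small 0) => _ /andP[].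
have mab := box_in md.
have mE : l (c m + c m) = m.
  have cm : {for m, continuous (fun r => l (c r + c r))} by exact: (@chart_add_cont id id).
  have cvS : l (e k.+1) @[k --> \oo] --> m by rewrite (cvg_shiftS (l \o e)).
  have : l (c (l (e k.+1)) + c (l (e k.+1))) @[k --> \oo] --> l (c m + c m).
    exact: (cvg_comp _ _ cvS cm).
  rewrite (_ : (fun k => _) = l \o e); last first.
    by apply/funext => k /=; rewrite (chartVK ch (proj1 (e_small _))) e_double.
  by move=> /(cvg_unique (@Rhausdorff R) cv).
have mP : small_nneg (c m).
  by split; [exact: chartP ch _ mab|rewrite (chartK ch mab) m0 -{1}(ger0_norm m0)].
have m_eq0 : m = 0.
  apply/eqP; rewrite eq_le m0 andbT leNgt; apply/negP => mgt0.
  have := small_nneg_ltD mP small_nneg0 mP.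
  by rewrite l0 (chartK ch mab) addr0 mE (chartK ch mab) ltxx => /(_ mgt0).
have : c (l (e k)) @[k --> \oo] --> c m.
  apply: (cvg_comp (l \o e) c cv); exact: chart_cont ch _ mab.
rewrite m_eq0 c0 (_ : (fun k => _) = e) //.
by apply/funext => k; exact: chartVK ch _ (proj1 (e_small _)).
Unshelve. all: by end_near. Qed.

Definition below (j : nat) := [set x | U x /\ 0 <= l x <= l (e j)].

Lemma below_small j x : below j x -> small_nneg x.
Proof.
move=> [Ux /andP[x0 xe]]; split; rewrite // x0 (le_lt_trans xe) //.
by case: (e_small j) => _ /andP[].
Qed.

Lemma halving_mulrn j i : e (j + i)%N *+ 2 ^ i = e j.
Proof.
elim: i => [|i IH]; first by rewrite addn0 mulr1n.
by rewrite addnS expnS mulrnA mulr2n e_double IH.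
Qed.

(** Induction on [i], with [m] split by parity: the even part is a multiple of the coarser step, and
    for odd [m] the extra half step stays below the next coarse multiple. *)
Lemma below_mulrn j i m : (m <= 2 ^ i)%N -> below j (e (j + i)%N *+ m).
Proof.
have [U0 l0] := chart_zero.
elim: i m => [|i IH] m.
  rewrite addn0 expn0; case: m => [|[|//]] _.
    by split; rewrite // mulr0n l0 lexx ltW.
  by split; [case: (e_small j)|rewrite mulr1n lexx ltW].
rewrite -[m]odd_double_half expnS mul2n => mle.
have -> : e (j + i.+1)%N *+ (odd m + (m./2).*2) =
    e (j + i)%N *+ m./2 + e (j + i.+1)%N *+ odd m.
  by rewrite mulrnDr [RHS]addrC -mul2n mulrnA mulr2n addnS e_double.
case: (odd m) mle => /= mle; last first.
  by rewrite mulr0n addr0; apply: IH; rewrite -leq_double.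
have {}mle : (m./2 < 2 ^ i)%N by rewrite -ltn_double.
have Px := below_small (IH _ (ltnW mle)).
have [Ux /andP[x0 _]] := IH _ (ltnW mle); rewrite mulr1n addnS.
have lt1 : l (e (j + i)%N *+ m./2 + 0) < l (e (j + i)%N *+ m./2 + e (j + i).+1).
  by apply: small_nneg_ltD => //; [exact: small_nneg0|rewrite l0].
have lt2 := small_nneg_ltD Px (e_small (j + i).+1) (e_small (j + i)) (e_lt _).
split; first exact: small_nneg_add.
rewrite addr0 in lt1; rewrite (ltW (le_lt_trans x0 lt1)) /= (le_trans (ltW lt2)) //.
by rewrite -mulrSr; case: (IH _ mle) => _ /andP[].
Qed.

Lemma closed_below j : closed (below j).
Proof.
apply: (closed_chart_itv ch hausdorffG a0).
by case: (e_small j) => _ /andP[_ /lt_trans]; apply.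
Qed.

(* [p r] is the limit of [e k *~ floor (r * 2 ^+ k)] along an ultrafilter on
   [nat], which spares a convergence proof. *)
Lemma one_parameter : exists p : R -> G, [/\ {morph p : r s / r + s},
  forall j r, 0 <= r <= 2 ^- j -> below j (p r) & forall j, p (2 ^- j) = e j].
Proof.
have [V [VU ooV]] := ultraFilterLemma (_ : ProperFilter \oo%classic).
pose x (r : R) k : G := e k *~ Num.floor (r * 2 ^+ k).
have [p pP] := choice (fun r => ultra_compact_cvg (x r) compactG VU).
have pow2 j i : 2 ^- j * 2 ^+ (j + i) = (2 ^ i)%N%:R :> R.
  by rewrite exprD mulrA mulVf ?expf_neq0 // mul1r natrX.
exists p; split.
- move=> r s; apply: (cvg_unique hausdorffG (pP (r + s))).
  (* The floor is additive up to 0 or 1, so the defect of additivity is at most one copy of [e k],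
     which tends to 0. *)
  pose err k : int := Num.floor ((r + s) * 2 ^+ k) - Num.floor (r * 2 ^+ k)
    - Num.floor (s * 2 ^+ k).
  have err01 k : err k = 0 \/ err k = 1.
    have := floor_itv (r * 2 ^+ k); have := floor_itv (s * 2 ^+ k).
    have := floor_itv ((r + s) * 2 ^+ k); rewrite /err mulrDl.
    move: (Num.floor (r * _)) (Num.floor (s * _)) (Num.floor _) => q n m.
    move=> /andP[m1 m2] /andP[n1 n2] /andP[q1 q2].
    rewrite !intrD !mulr1z in m2 n2 q2.
    have : m < n + q + 1 + 1 by rewrite -(ltr_int R) !intrD !mulr1z; lra.
    have : n + q < m + 1 by rewrite -(ltr_int R) !intrD !mulr1z; lra.
    lia.
  have errV : e k *~ err k @[k --> V] --> (0 : G).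
    move=> N N0; apply: ooV; have := halving_cvg0 N0; rewrite /nbhs /=.
    apply: filterS => k Nk; rewrite /= .
    by case: (err01 k) => ->; rewrite ?mulr0z ?mulr1z //; exact: nbhs_singleton.
  have -> : x (r + s) = fun k => x r k + x s k + e k *~ err k.
    apply/funext => k; rewrite /x -!mulrzDr; congr (_ *~ _).
    by rewrite /err; lia.
  rewrite -[p r + p s]addr0.
  apply: (cvg_comp2 _ errV (@add_continuous G (_, _))).
  exact: (cvg_comp2 (pP r) (pP s) (@add_continuous G (_, _))).
- move=> j r /andP[r0 rj]; apply: (closed_cvg _ (@closed_below j)) (pP r).
  apply: ooV; exists j => // k /= /subnKC <-; move: (k - j)%N => i.
  rewrite /x; have : 0 <= r * 2 ^+ (j + i) by rewrite mulr_ge0 // exprn_ge0.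
  rewrite -floor_ge0; case E : (Num.floor _) => [m|//] _.
  apply: below_mulrn; rewrite -(ler_nat R) -(pow2 j).
  have := floor_le (r * 2 ^+ (j + i)); rewrite E => /le_trans; apply.
  by rewrite ler_wpM2r // exprn_ge0.
- move=> j; apply: (cvg_unique hausdorffG (pP _)).
  (* For [r] = 2^-j the sequence is constantly [e j] from index [j] on. *)
  apply: cvg_near_cst; apply: ooV; exists j => // k /= /subnKC <-.
  by rewrite /x pow2 -[_%:R]/((2 ^ (k - j))%N%:~R) intrKfloor -pmulrn halving_mulrn.
Qed.

Lemma below_nbhs0 N : nbhs 0 N -> exists j, below j `<=` N.
Proof.
move=> N0; have [U0 l0] := chart_zero; have ab : a < 0 < b by rewrite a0 b0.
have cN : nbhs (0 : R) (c @^-1` N) by apply: (chart_cont ch ab); rewrite c0.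
have [q1 [q [/andP[_ q10] /andP[q0 _] qN]]] := nbhs_itv_inside ab cN.
have /cvgr_lt/(_ _ q0)[j _ /(_ j (leqnn _))/= ejq] : l (e k) @[k --> \oo] --> 0.
  rewrite -l0; apply: (cvg_comp e l); first exact: halving_cvg0.
  exact: chartV_cont ch _ U0.
exists j => x [Ux /andP[x0 xe]]; rewrite -(chartVK ch Ux); apply: qN.
by rewrite (lt_le_trans q10 x0) (le_lt_trans xe ejq).
Qed.

Lemma one_parameter_local : exists p : R -> G, [/\ {morph p : r s / r + s},
  continuous p, forall r, 0 < r <= 1 -> p r <> 0 &
  exists W : set G, [/\ open W, W !=set0 & W `<=` p @` `[0, 1]]].
Proof.
have [p [pD p_below pe]] := one_parameter.
have [U0 l0] := chart_zero.
have p0 : p 0 = 0 by apply: (@addrI _ (p 0)); rewrite -pD !addr0.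
have pN r : p (- r) = - p r by apply: (@addrI _ (p r)); rewrite -pD !subrr.
have below0 r : 0 <= r <= 1 -> below 0 (p r).
  by move=> r01; apply: p_below; rewrite expr0 invr1.
have pc : continuous p.
  move=> r0 N Nr0.
  have : nbhs 0 [set y | N (p r0 + y) /\ N (p r0 - y)].
    apply: filterI.
      apply: (cvg_comp2 (cvg_cst (p r0)) cvg_id (@add_continuous G (_, _))).
      by rewrite /= addr0.
    have oc := @opp_continuous G 0.
    apply: (cvg_comp2 (cvg_cst (p r0)) oc (@add_continuous G (_, _))).
    by rewrite /= subr0.
  move=> /below_nbhs0[j jN].
  have j0 : 0 < 2 ^- j :> R by rewrite invr_gt0 exprn_gt0.
  have : \forall r \near r0, `|r0 - r| < 2 ^- j.
    by apply/nbhs_ballP; exists (2 ^- j).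
  rewrite /nbhs /=; apply: filterS => r rj /=.
  have [r0r|rr0] := leP r0 r.
    rewrite -(subrKC r0 r) pD; apply: (proj1 (jN _ _)); apply: p_below.
    by rewrite subr_ge0 r0r /= ltW // -[r - r0]ger0_norm ?subr_ge0 // distrC.
  rewrite -(subKr r0 r) pD pN; apply: (proj2 (jN _ _)); apply: p_below.
  by rewrite subr_ge0 (ltW rr0) /= ltW // -[r0 - r]ger0_norm ?subr_ge0 // ltW.
exists p; split => //.
- move=> r /andP[r0 r1] pr0.
  (* Write [p r] as [p (r - 2 ^- j) + e j]: its coordinate strictly exceeds a nonnegative one. *)
  have [j jr] : exists j, 2 ^- j <= r.
    exists (Num.bound r^-1); rewrite invf_ple ?posrE ?exprn_gt0 //.
    exact/ltW/upper_nthrootP.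
  have j0 : 0 < 2 ^- j :> R by rewrite invr_gt0 exprn_gt0.
  have By : below 0 (p (r - 2 ^- j)) by apply: below0; lra.
  have Py := below_small By.
  have : l (p (r - 2 ^- j) + 0) < l (p (r - 2 ^- j) + e j).
    by apply: small_nneg_ltD => //; [exact: small_nneg0|rewrite l0].
  rewrite addr0 -pe -pD subrK pr0 l0 ltNge.
  by case: By => _ /andP[->].
- exists [set x | U x /\ 0 < l x < l (e 0%N)]; split.
  + apply: (open_chart_itv ch); first exact: ltW.
    by case: (e_small 0) => _ /andP[_ ed]; rewrite ltW // (lt_trans ed db).
  + by exists (e 1%N); split; [case: (e_small 1)|rewrite e_gt0 e_lt].
  + move=> x [Ux /andP[x0 xe]].
    have cf : {within `[0, 1], continuous (l \o p)}.
      apply: continuous_in_subspaceT => r /set_mem /=; rewrite in_itv /= => r01.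
      by apply: continuous_comp; [exact: pc|apply: (chartV_cont ch); case: (below0 _ r01)].
    have p1 : p 1 = e 0%N by rewrite -pe expr0 invr1.
    have [|r r01 lpr] := IVT ler01 cf (v := l x).
      by rewrite /= p0 l0 p1 ge_min le_max (ltW x0) (ltW xe) orbT.
    exists r => //; rewrite -(chartVK ch Ux) -lpr /= (chartVK ch) //.
    by move: r01; rewrite in_itv /= => /below0[].
Qed.

End LocalOrder.

(** * One-parameter subgroups *)

Section OneParameterSubgroup.
Context (R : realType) (G : topologicalZmodType).
Hypotheses (compactG : compact [set: G]) (connectedG : connected [set: G]).
Hypothesis hausdorffG : hausdorff_space G.
Context (p : R -> G).
Hypotheses (pD : {morph p : r s / r + s}) (pc : continuous p)
  (p_neq0 : forall r, 0 < r <= 1 -> p r <> 0).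
Context (W : set G).
Hypotheses (oW : open W) (W0 : W !=set0) (Wp : W `<=` p @` `[0, 1]).

Lemma oneparam0 : p 0 = 0.
Proof. by apply: (@addrI _ (p 0)); rewrite -pD !addr0. Qed.

Lemma oneparamN r : p (- r) = - p r.
Proof. by apply: (@addrI _ (p r)); rewrite -pD !subrr oneparam0. Qed.

Lemma oneparamMz (n : int) r : p (n%:~R * r) = p r *~ n.
Proof.
have pn (k : nat) : p (k%:R * r) = p r *+ k.
  elim: k => [|k IH]; first by rewrite mul0r oneparam0.
  by rewrite -natr1 mulrDl mul1r pD IH mulrSr.
by case: n => k; rewrite ?NegzE ?mulrNz ?mulNr ?oneparamN -?pmulrn pn.
Qed.

(** Translate [W] so that one of its points [p s] goes to [x]; differences of parameters in [0, 1]
    have absolute value at most 1. *)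
Lemma near_image_shift x : \forall y \near x,
  exists2 s, `|s| <= 1 & y = x + p s.
Proof.
have [t Wt] := W0; have [s /= s01 ps] := Wp Wt; rewrite in_itv /= in s01.
have : nbhs x [set y | W (t + (y - x))].
  have c1 : y - x @[y --> x] --> (0 : G).
    rewrite -[X in _ --> X](subrr x).
    exact: (cvg_comp2 cvg_id (cvg_cst (- x)) (@add_continuous G (_, _))).
  apply: (cvg_comp2 (cvg_cst t) c1 (@add_continuous G (_, _))).
  by rewrite /= addr0; exact: open_nbhs_nbhs.
apply: filterS => y /Wp[r /=]; rewrite in_itv /= => r01 pr.
exists (r - s); first by rewrite ler_norml; lra.
by rewrite pD oneparamN pr ps addrAC subrr add0r subrKC.
Qed.

(** The image of [p] is an open subgroup, hence also closed, and the group is connected. *)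
Lemma one_parameter_surj x : exists r, p r = x.
Proof.
suff E : p @` setT = setT by have [r _ prx] : (p @` setT) x; [rewrite E|exists r].
apply: connectedG; first by exists 0, 0 => //; exact: oneparam0.
- exists (p @` setT); last by rewrite setTI.
  rewrite openE => _ [r _ <-]; apply: filterS (near_image_shift (p r)) => y [s _ ->].
  by exists (r + s).
- exists (p @` setT); last by rewrite setTI.
  rewrite -[p @` _]setCK; apply: open_closedC; rewrite openE => y ny.
  apply: filterS (near_image_shift y) => z [s _ zE] [r _ prz]; apply: ny.
  by exists (r - s); rewrite // pD oneparamN prz zE addrK.
Qed.

(** By compactness some [p m] with [m] large returns close to a limit point [p r], which yields a
    positive element of the kernel. Distinct elements of the kernel are at least 1 apart, so there
    is a least positive one, [T], and division with remainder shows that it generates the kernel. *)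
Lemma one_parameter_period : exists2 T, 0 < T &
  forall r, p r = 0 <-> exists n : int, r = n%:~R * T.
Proof.
have [V [VU ooV]] := ultraFilterLemma (_ : ProperFilter \oo%classic).
have [x px] := ultra_compact_cvg (fun n : nat => p n%:R) compactG VU.
have [r prx] := one_parameter_surj x.
have {px}[m [rm [s s1 pm]]] : exists m : nat,
    r + 1 < m%:R /\ exists2 s, `|s| <= 1 & p m%:R = x + p s.
  (* Taking [m] > [r] + 1 makes [m - r - s] positive whenever [s] is at most 1 in absolute value. *)
  have Vm : V [set m : nat | r + 1 < m%:R] by apply: ooV; exact: nbhs_infty_gtr.
  have Vs := px _ (near_image_shift x); rewrite /nbhs /= in Vs.
  by have [m [mr ms]] := filter_ex (filterI Vm Vs); exists m.
pose K := [set t : R | 0 < t /\ p t = 0].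
have K0 : K !=set0.
  exists (m%:R - r - s); split; first by move: s1; rewrite ler_norml; lra.
  by rewrite !pD !oneparamN prx pm addrAC addrK subrr.
have lbK : lbound K 1.
  by move=> t [t0 pt]; rewrite leNgt; apply/negP => t1; apply: (@p_neq0 t) => //; lra.
have hK : has_inf K by split => //; exists 1.
have KB t u : K t -> K u -> t < u -> 1 <= u - t.
  move=> [t0 pt] [u0 pu] tu; apply: lbK; split; first by rewrite subr_gt0.
  by rewrite pD oneparamN pt pu subrr.
(* [T] lies within 1 of the infimum, so a smaller element, at least 1 below it, would lie under the
   infimum. *)
have [T KT Tlt] := inf_adherent ltr01 hK.
have Tmin t : K t -> T <= t.
  move=> Kt; rewrite leNgt; apply/negP => tT; have := KB _ _ Kt KT tT.
  have := ge_inf hK.2 Kt; lra.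
have [T0 pT] := KT; exists T => // t; split; last first.
  by move=> [n ->]; rewrite oneparamMz pT mul0rz.
move=> pt; exists (Num.floor (t / T)).
have /andP[f1 f2] := floor_itv (t / T).
rewrite ler_pdivlMr // in f1; rewrite ltr_pdivrMr // intrD mulrDl mul1r in f2.
apply/eqP; rewrite eq_le f1 andbT leNgt; apply/negP => lt.
have /Tmin : K (t - (Num.floor (t / T))%:~R * T).
  by split; [rewrite subr_gt0|rewrite pD oneparamN oneparamMz pT pt mul0rz subrr].
lra.
Qed.

End OneParameterSubgroup.

(** * The circle *)

Section Circle.
Context (R : realType).
Implicit Types t : R.

(** Restricted to the compact segment [0, T], [q] is a closed surjection, so closedness of a
    preimage under [f] can be tested upstairs. *)
Lemma quotient_segment_continuous (A B : topologicalType) (q : R -> A) (T : R)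
    (f : A -> B) :
  hausdorff_space A -> continuous q -> continuous (f \o q) ->
  (forall x, exists2 r, 0 <= r <= T & q r = x) -> continuous f.
Proof.
move=> hA cq cfq q_surj; apply/continuous_closedP => C clC.
have -> : f @^-1` C = q @` (`[0, T] `&` (f \o q) @^-1` C).
  apply/seteqP; split => [x Cx|_ [r [_ ?] <-] //].
  by have [r rT qr] := q_surj x; exists r; rewrite // /= qr in_itv.
apply: (compact_closed hA); apply: continuous_compact.
  exact: continuous_subspaceT.
apply: compact_closedI; first exact: segment_compact.
exact: (proj1 (continuous_closedP _)).
Qed.

(** The exponential exp(2 i pi t), normalised to have period 1. *)
Definition expi t : R[i] := cos (2 * pi * t) +i* sin (2 * pi * t).

Lemma expi_circle t : expi t \in [set z : R[i]^o | `|z| = 1 :> R[i]].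
Proof. by apply: mem_set; rewrite /= normc_def /= cos2Dsin2 sqrtr1. Qed.

Definition circle_of t : circle R := exist _ (expi t : R[i]^o) (expi_circle t).

Lemma circle_eq (z w : circle R) : \val z = \val w -> z = w.
Proof. exact: val_inj. Qed.

Lemma expiD s t : expi (s + t) = expi s * expi t.
Proof. by rewrite /expi mulrDr cosD sinD; simpc; congr (_ +i* _); rewrite addrC. Qed.

Lemma expi1 : expi 1 = 1.
Proof. by rewrite /expi mulr1 mulr_natl cos2pi sin2pi. Qed.

Lemma expi_neq0 t : expi t != 0.
Proof.
by rewrite -normr_gt0; have /set_mem /= -> := expi_circle t; exact: ltr01.
Qed.

Lemma expi_int (n : int) : expi n%:~R = 1.
Proof.
have e0 : expi 0 = 1 by rewrite /expi mulr0 cos0 sin0.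
have en (k : nat) : expi k%:R = 1.
  by elim: k => [//|k IH]; rewrite -natr1 expiD IH expi1 mulr1.
case: n => k; first exact: en.
by have := expiD k.+1%:R (- k.+1%:R); rewrite subrr e0 en mul1r NegzE mulrNz.
Qed.

(** The fractional part of [t] has cosine 1. Injectivity of the cosine on [0, pi] settles the first
    half turn, and the reflection u -> 1 - u excludes the second. *)
Lemma expi_eq1 t : expi t = 1 -> exists n : int, t = n%:~R.
Proof.
move=> et; exists (Num.floor t); have /andP[f1 f2] := floor_itv t.
rewrite intrD mulr1z in f2; set f := (Num.floor t)%:~R in f1 f2 *.
have [c1 _] : cos (2 * pi * (t - f)) = 1 /\ sin (2 * pi * (t - f)) = 0.
  suff [-> ->] : expi (t - f) = 1 by [].
  by rewrite expiD et -mulrNz expi_int mul1r.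
have pi0 := pi_gt0 R; apply/eqP; rewrite -subr_eq0; apply/eqP.
have cos_eq1 (u : R) : 0 <= u <= 1 / 2 -> cos (2 * pi * u) = 1 -> u = 0.
  move=> /andP[u0 u1] cu.
  have upi : 0 <= 2 * pi * u <= pi.
    apply/andP; split; first by rewrite !mulr_ge0 ?pi_ge0.
    by rewrite mulrAC ger_pMl //; lra.
  have /eqP : 2 * pi * u = 0.
    apply: cos_inj; last by rewrite cos0.
      by rewrite in_itv /= upi.
    by rewrite in_itv /= lexx pi_ge0.
  by rewrite mulf_eq0 => /orP[|/eqP //]; rewrite mulf_eq0 pnatr_eq0 /= gt_eqF.
have [le|gt] := leP (t - f) (1 / 2); first by apply: cos_eq1 => //; lra.
have : 1 - (t - f) = 0.
  apply: cos_eq1; first by lra.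
  rewrite mulrBr mulr1 mulr_natl -cosN opprB.
  by rewrite -[LHS]cosD2pi subrK -mulr_natl.
lra.
Qed.

Lemma circle_of_eq s t : circle_of s = circle_of t -> exists n : int, s = t + n%:~R.
Proof.
move=> /(congr1 val) /= est.
have [|n nE] := @expi_eq1 (s - t); last by exists n; rewrite -nE subrKC.
by apply: (mulIf (expi_neq0 t)); rewrite -expiD subrK mul1r.
Qed.

Lemma circle_of_surj (z : circle R) : exists2 t, 0 <= t <= 1 & circle_of t = z.
Proof.
case: z => -[x y] xy; have := set_mem xy; rewrite /= normc_def /= => -[].
move=> /(congr1 (fun u => u ^+ 2)).
rewrite sqr_sqrtr ?addr_ge0 ?sqr_ge0 // expr1n => xy1.
have x1 : -1 <= x <= 1.
  by rewrite -ler_norml -(@expr_le1 _ 2) // -normrX ger0_norm ?sqr_ge0 //; nra.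
have [/andP[a0 a1] ax] := acos_def x1; have pi0 := pi_gt0 R.
have pi2 : 2 * pi != 0 :> R by rewrite mulf_neq0 // ?pnatr_eq0 // gt_eqF.
have sa : sin (acos x) = `|y|.
  by rewrite sin_acos // -xy1 addrC addKr sqrtr_sqr.
have a_le : 0 <= acos x / (2 * pi) <= 1.
  by rewrite divr_ge0 ?mulr_ge0 ?pi_ge0 //= ler_pdivrMr ?mulr_gt0 //; lra.
(* On the lower half circle the angle is a full turn minus the arccosine. *)
have [y0|y0] := leP 0 y.
  exists (acos x / (2 * pi)) => //; apply: circle_eq => /=.
  by rewrite /expi mulrC divfK // ax sa ger0_norm.
exists (1 - acos x / (2 * pi)); first by lra.
apply: circle_eq => /=; rewrite expiD expi1 mul1r.
by rewrite /expi mulrN mulrC divfK // cosN sinN ax sa ltr0_norm // opprK.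
Qed.

Lemma continuous_real_complex : continuous (fun x : R => x%:C : R[i]^o).
Proof.
move=> x; apply/cvgrPdist_lt => -[e e'] /=; rewrite ltcE /= => /andP[/eqP -> e0].
apply/nbhs_ballP; exists e => // y; rewrite /ball /= => xy.
by rewrite -rmorphB /= normc_def /= expr0n /= addr0 sqrtr_sqr ltcR.
Qed.

Lemma continuous_circle_of : continuous circle_of.
Proof.
apply: (@continuous_comp_initial _ _ _ (\val : circle R -> R[i]^o)).
have -> : \val \o circle_of =
    (fun t => (cos (2 * pi * t))%:C + 'i%C * (sin (2 * pi * t))%:C : R[i]^o).
  by apply/funext => t; rewrite /= [LHS]complexE.
move=> t; have c2 : {for t, continuous (fun t : R => 2 * pi * t)}.
  by apply: cvgM; [exact: cvg_cst|exact: cvg_id].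
apply: cvgD.
  apply: (continuous_comp (f := fun t => cos (2 * pi * t))
    (g := fun x : R => x%:C : R[i]^o)); last exact: continuous_real_complex.
  exact: (continuous_comp c2 (@continuous_cos _ _)).
apply: cvgM; first exact: cvg_cst.
apply: (continuous_comp (f := fun t => sin (2 * pi * t))
  (g := fun x : R => x%:C : R[i]^o)); last exact: continuous_real_complex.
exact: (continuous_comp c2 (@continuous_sin _ _)).
Qed.

Lemma hausdorff_circle : hausdorff_space (circle R).
Proof.
move=> z w zw; apply: circle_eq; apply: (@norm_hausdorff _ R[i]^o) => V W Vz Ww.
have c1 := @initial_continuous (circle R) R[i]^o \val.
have [u [Vu Wu]] := zw _ _ (c1 _ _ Vz) (c1 _ _ Ww).
by exists (\val u).
Qed.

End Circle.

(** * From free intervals to charts, and continuity of inversion *)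

Lemma continuous_open_extension (X Y : topologicalType) (A : set X) (f : A -> Y)
    (F : X -> Y) x :
  open A -> continuous f -> (forall y : A, F (\val y) = f y) -> A x ->
  {for x, continuous F}.
Proof.
move=> oA cf Ff Ax N NFx; pose x' : A := exist _ x (mem_set Ax).
have : nbhs x' (f @^-1` N) by apply: cf; rewrite -Ff.
case=> V /= [[W oW <-] Wx VN].
have nA : nbhs x A by exact: open_nbhs_nbhs.
have nW : nbhs x W by exact: open_nbhs_nbhs.
rewrite /nbhs /=; apply: filterS2 nA nW => y Ay Wy /=.
by have := VN (exist _ y (mem_set Ay)) Wy; rewrite /= -Ff.
Qed.

Lemma free_interval_chart (R : realType) (X : topologicalType) (U : set X) :
  free_interval R U -> exists c l, chart U (0 : R) 1 c l.
Proof.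
move=> [oU [h [ch [g [cg hK gK]]]]].
have half01 : (`]0, 1[%classic : set R) (1 / 2) by rewrite /= in_itv /=; lra.
(* Outside the interval [c] takes the value of the midpoint, and outside [U] the map [l] is 0; these
   defaults are arbitrary. *)
pose c (r : R) : X := if pselect ((`]0, 1[%classic : set R) r) is left rI
  then \val (g (exist _ r (mem_set rI)))
  else \val (g (exist _ (1 / 2) (mem_set half01))).
pose l (x : X) : R := if pselect (U x) is left Ux
  then \val (h (exist _ x (mem_set Ux))) else 0.
have cE (r : (`]0, 1[%classic : set R)) : c (\val r) = \val (g r).
  rewrite /c; case: pselect => [rI|[]]; last exact: set_valP.
  by congr (\val (g _)); exact: val_inj.
have lE (x : U) : l (\val x) = \val (h x).
  rewrite /l; case: pselect => [Ux|[]]; last exact: set_valP.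
  by congr (\val (h _)); exact: val_inj.
have itvE r : 0 < r < 1 -> (`]0, 1[%classic : set R) r by rewrite /= in_itv.
have valc : continuous (\val : U -> X) by exact: initial_continuous.
have vall : continuous (\val : (`]0, 1[%classic : set R) -> R).
  exact: initial_continuous.
exists c, l; split => //.
- by move=> r /itvE r01; rewrite /c; case: pselect => // ?; exact: set_valP.
- move=> x Ux; rewrite -[x]/(\val (exist _ x (mem_set Ux) : U)) lE.
  by have := set_valP (h (exist _ x (mem_set Ux))); rewrite /= in_itv.
- move=> r /itvE r01.
  rewrite -[r]/(\val (exist _ r (mem_set r01) : (`]0, 1[%classic : set R))).
  by rewrite cE lE gK.
- move=> x Ux.
  by rewrite -[x]/(\val (exist _ x (mem_set Ux) : U)) lE cE hK.
- move=> r /itvE r01; apply: (continuous_open_extension _ _ cE r01).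
    exact: itv_open.
  by move=> y; apply: continuous_comp; [exact: cg|exact: valc].
- move=> x Ux; apply: (continuous_open_extension oU _ lE Ux).
  by move=> y; apply: continuous_comp; [exact: ch|exact: vall].
Qed.

Lemma chart_shift (R : realType) (X : topologicalType) (U : set X) (a b s : R) c l :
  chart U a b c l ->
  chart U (a - s) (b - s) (fun r => c (r + s)) (fun x => l x - s).
Proof.
move=> ch; have itvE r : a - s < r < b - s -> a < r + s < b by lra.
split.
- exact: chart_open ch.
- by move=> r /itvE; exact: chartP ch _.
- by move=> x /(chartVP ch); lra.
- by move=> r /itvE ra; rewrite (chartK ch ra) addrK.
- by move=> x Ux; rewrite subrK (chartVK ch Ux).
- move=> r /itvE ra; apply: (continuous_comp (f := fun r => r + s)).
    by apply: cvgD; [exact: cvg_id|exact: cvg_cst].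
  exact: chart_cont ch _ ra.
- move=> x Ux; apply: (cvgB (chartV_cont ch Ux)); exact: cvg_cst.
Qed.

(** The graph of [opp] is closed, being a fibre of the continuous addition. The preimage of a closed
    set is thus the projection of a compact set. *)
Lemma continuous_opp_compact (X : topologicalType) (add : X -> X -> X)
    (opp : X -> X) (e : X) :
  compact [set: X] -> hausdorff_space X ->
  continuous (fun z : X * X => add z.1 z.2) ->
  (forall x y, add x y = e <-> y = opp x) -> continuous opp.
Proof.
move=> compactX hX cadd oppE; apply/continuous_closedP => C clC.
pose D := (fun z : X * X => add z.1 z.2) @^-1` [set e] `&` snd @^-1` C.
have -> : opp @^-1` C = fst @` D.
  apply/seteqP; split => [x Cx|_ [[x y] [/= /oppE -> Cy] <-] //].
  by exists (x, opp x) => //; split => //=; exact/oppE.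
apply: compact_closed => //; apply: continuous_compact.
  by apply: continuous_subspaceT => z; exact: cvg_fst.
apply: (@subclosed_compact _ _ ([set: X] `*` [set: X])).
- apply: closedI; apply: (proj1 (continuous_closedP _)) => //.
    by apply: compact_closed => //; exact: compact_set1.
  by move=> z; exact: cvg_snd.
- exact: compact_setX.
- by [].
Qed.

(** * Compact connected abelian groups with a free interval are circles *)

Section CompactGroup.
Context (R : realType) (G : topologicalZmodType).
Hypotheses (compactG : compact [set: G]) (connectedG : connected [set: G]).
Hypothesis hausdorffG : hausdorff_space G.
Context (U : set G) (a b : R) (c : R -> G) (l : G -> R).
Hypotheses (ch : chart U a b c l) (U0 : U 0).

Lemma compact_connected_group_circle : exists h : G -> circle R,
  homeomorphism h /\ forall x y, \val (h (x + y)) = \val (h x) * \val (h y).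
Proof.
have chs := chart_shift (l 0) ch; have /andP[al lb] := chartVP ch U0.
have as0 : a - l 0 < 0 by rewrite subr_lt0.
have bs0 : 0 < b - l 0 by rewrite subr_gt0.
have cs0 : c (0 + l 0) = 0 by rewrite add0r (chartVK ch U0).
have [d [d0 ad db addU]] := addable_box chs as0 bs0 cs0.
have [e eP] := halving_exists chs as0 bs0 cs0 d0 ad db addU.
have [p [pD pc p_neq0 [W [oW W0 Wp]]]] :=
  one_parameter_local compactG hausdorffG chs as0 bs0 cs0 d0 ad db addU eP.
have p_surj := one_parameter_surj connectedG pD oW W0 Wp.
have [T T0 pT] := one_parameter_period compactG connectedG pD p_neq0 oW W0 Wp.
have Tn0 : T != 0 by rewrite gt_eqF.
have [r rP] := choice p_surj.
have circle_ofP (z : circle R) : exists t, circle_of t = z.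
  by have [t _ tz] := circle_of_surj z; exists t.
have [t tP] := choice circle_ofP.
(* [r] and [t] are arbitrary sections of [p] and [circle_of]. The kernels match after scaling by
   [T], so [h] and [g] depend on no choice. *)
pose h x := circle_of (r x / T).
pose g z := p (T * t z).
have hp u : h (p u) = circle_of (u / T).
  have /pT[n nE] : p (r (p u) - u) = 0 by rewrite pD oneparamN // rP subrr.
  apply: circle_eq; rewrite /h /= -[r (p u)](subrK u) nE mulrDl expiD mulfK //.
  by rewrite expi_int mul1r.
have gc u : g (circle_of u) = p (T * u).
  have [n nE] := circle_of_eq (tP (circle_of u)).
  rewrite /g nE mulrDr pD (_ : p (T * n%:~R) = 0) ?addr0 //.
  by apply/pT; exists n; rewrite mulrC.
have p_surjT x : exists2 u, 0 <= u <= T & p u = x.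
  have /andP[f1 f2] := floor_itv (r x / T).
  exists (r x - (Num.floor (r x / T))%:~R * T); last first.
    rewrite pD oneparamN // (_ : p (_ * T) = 0) ?subr0 ?rP //.
    by apply/pT; exists (Num.floor (r x / T)).
  rewrite ler_pdivlMr // in f1; rewrite ltr_pdivrMr // intrD mulrDl mul1r in f2.
  by rewrite subr_ge0 f1 /= lerBlDl ltW.
exists h; split; last first.
  move=> x y; rewrite -(rP x) -(rP y) -pD !hp /= mulrDl; exact: expiD.
split.
- apply: (quotient_segment_continuous hausdorffG pc _ p_surjT).
  have -> : h \o p = @circle_of R \o (fun u => u / T) by apply/funext => u; exact: hp.
  move=> u; apply: continuous_comp; last exact: continuous_circle_of.
  by apply: cvgM; [exact: cvg_id|exact: cvg_cst].
- exists g; split.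
  + apply: (quotient_segment_continuous (@hausdorff_circle R)
      (@continuous_circle_of R) _ (@circle_of_surj R)).
    have -> : g \o @circle_of R = p \o (fun u => T * u) by apply/funext => u; exact: gc.
    move=> u; apply: continuous_comp; last exact: pc.
    by apply: cvgM; [exact: cvg_cst|exact: cvg_id].
  + by move=> x; rewrite -(rP x) hp gc mulrC divfK.
  + by move=> z; rewrite -{1}(tP z) gc hp mulrAC divff // mul1r tP.
Qed.

End CompactGroup.

(** * Minimal actions *)

Section MinimalGroup.
Context (R : realType) (X : topologicalType).
Hypotheses (compactX : compact [set: X]) (connectedX : connected [set: X]).
Hypothesis hausdorffX : hausdorff_space X.
Context (S : choiceType) (phi : S -> X -> X).
Hypotheses (phi_cont : forall s, continuous (phi s))
  (phiC : forall s t x, phi s (phi t x) = phi t (phi s x))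
  (phi_dense : forall x, dense (range (phi^~ x))).
Context (U : set X) (a b : R) (c : R -> X) (l : X -> R).
Hypotheses (ch : chart U a b c l).
Context (e : X).
Hypothesis (Ue : U e).

(* The maps commuting with all [phi s] act simply transitively on [X], so
   evaluation at [e] transports their composition to [X]. *)
Lemma minimal_circle : exists2 h : X -> circle R, homeomorphism h &
  forall s x, \val (h (phi s x)) = \val (h (phi s e)) * \val (h x).
Proof.
have U_neq0 : U !=set0 by exists e.
have trans :=
  central_transitive compactX hausdorffX phi_cont phiC phi_dense ch U_neq0.
have eqC f g x := @commuting_eq X hausdorffX S phi phi_dense f g x.
have tau_ex x : exists g, central phi g /\ g e = x.
  by have [g gC gx] := trans e x; exists g.
(* [tau x] is translation by [x], the unique commuting map sending [e] to [x]; the sum of [x] and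
   [y] is [tau x y]. *)
have [tau tauP] := choice tau_ex.
have opp_ex x : exists y g, [/\ central phi g, g x = e & g e = y].
  by have [g gC gx] := trans x e; exists (g e), g.
have [opp oppP] := choice opp_ex.
have tC x : commuting phi (tau x) by case: (tauP x) => [[]].
have te x : tau x e = x by case: (tauP x).
have tau_eq g x : commuting phi g -> g e = x -> g =1 tau x.
  by move=> gC gx; apply: (eqC _ _ e) => //; rewrite te.
have addC x y : tau x y = tau y x.
  have [[_ /(_ _ (tC y) e)/=]] := tauP x.
  by rewrite !te.
have addA x y z : tau x (tau y z) = tau (tau x y) z.
  by apply: (tau_eq (tau x \o tau y)) => /=; [exact: commuting_comp|rewrite te].
have add0 x : tau e x = x by rewrite -(tau_eq id e) //; exact: commuting_id.
have addN x : tau (opp x) x = e.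
  by have [g [[gC _] gx ge]] := oppP x; rewrite -(tau_eq g).
pose Z : PreTopologicalZmodule.type :=
  HB.pack (X : Type) X (GRing.isZmodule.Build X addA addC add0 addN).
have tauE (x y : Z) : tau x y = x + y by [].
have cD (x : Z) : continuous (fun y : Z => x + y) by exact: (tC x).1.
have cadd : continuous (fun z : Z * Z => z.1 + z.2).
  (* Translations reduce joint continuity to the point ([e], [e]), where it is even continuity of
     the maps [tau]. *)
  move=> [x y] N /= Nxy.
  have N0 : nbhs (0 : Z) [set z | N (x + y + z)].
    by apply: (cD (x + y)); rewrite /= addr0.
  have [A [B [A0 B0 AB]]] :=
    even_continuity hausdorffX phi_cont phiC phi_dense ch Ue Ue N0.
  have nx : nbhs x [set x' : Z | B (- x + x')].
    by apply: (cD (- x)); rewrite /= addNr.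
  have ny : nbhs y [set y' : Z | A (- y + y')].
    by apply: (cD (- y)); rewrite /= addNr.
  exists ([set x' : Z | B (- x + x')], [set y' : Z | A (- y + y')]) => //=.
  move=> [x' y'] /= [Bx Ay].
  have := AB _ (tC (- x + x')); rewrite te => /(_ Bx _ Ay).
  by rewrite /= tauE addrACA !addNKr.
have copp : continuous (fun x : Z => - x).
  apply: (@continuous_opp_compact Z +%R _ 0) => // x y.
  by split => [xy|->]; [apply: (@addrI _ x); rewrite xy|]; rewrite subrr.
pose G : topologicalZmodType := HB.pack (X : Type) Z
  (PreTopologicalNmodule_isTopologicalNmodule.Build Z cadd)
  (TopologicalNmodule_isTopologicalZmodule.Build Z copp).
have chG : @chart R G U a b c l by case: ch => *; split.
have [h [hh hD]] := @compact_connected_group_circle R G compactX connectedX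
  hausdorffX U a b c l chG Ue.
exists h => // s x; rewrite -(hD (phi s e : G) (x : G)); congr (\val (h _)).
(* By uniqueness, [phi s] is translation by [phi s e]. *)
by rewrite -[RHS]/(tau (phi s e) x) -(tau_eq (phi s)) //; exact: commuting_phi.
Qed.

End MinimalGroup.

(** * Transport of the action to the circle *)

Section Conjugate.
Context (R : realType) (X : topologicalType) (S : addSemigroupType).

Lemma acting_map_continuous (Phi : action S X) s : continuous (acting_map Phi s).
Proof.
move=> x; apply: (continuous_comp (f := fun x => (s : discrete_topology S, x))
  (g := Phi : discrete_topology S * X -> X)).
  exact: (cvg_pair (cvg_cst (s : discrete_topology S)) cvg_id).
exact: (@action_continuous S X Phi).
Qed.

Lemma conjugate_action (Y : topologicalType) (Phi : action S X)
    (h : X -> Y) (g : Y -> X) :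
  continuous h -> continuous g -> cancel h g -> cancel g h ->
  exists Psi : action S Y, forall s y, acting_map Psi s y = h (acting_map Phi s (g y)).
Proof.
move=> ch cg hK gK.
pose psi (z : discrete_topology S * Y) : Y := h (Phi (z.1, g z.2)).
have cpsi : continuous psi.
  move=> z; apply: (continuous_comp
    (f := fun z : discrete_topology S * Y => Phi (z.1, g z.2))); last exact: ch.
  apply: (continuous_comp (f := fun z : discrete_topology S * Y => (z.1, g z.2)));
    last exact: (@action_continuous S X Phi).
  have c2 : {for z, continuous (fun z : discrete_topology S * Y => g z.2)}.
    by apply: continuous_comp; [exact: cvg_snd|exact: cg].
  exact: (cvg_pair cvg_fst c2).
have psiD (s t : S) y : psi (s, psi (t, y)) = psi (s + t, y).
  by rewrite /psi /= hK action_add.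
by exists (Action cpsi psiD).
Qed.

End Conjugate.

Theorem theoremB (R : realType) (X : topologicalType)
    (compactX : compact [set: X]) (connectedX : connected [set: X])
    (hausdorffX : hausdorff_space X)
    (free_intervalX : exists U : set X, free_interval R U)
    (S : addSemigroupType) (nonemptyS : [set: S] !=set0)
    (Phi : action S X) (minimalPhi : minimal_action Phi) :
  exists Psi : action S (circle R), by_rotations Psi /\ conjugate_actions Phi Psi.
Proof.
have [U /free_interval_chart[c [l ch]]] := free_intervalX.
have I12 : (0 : R) < (1 / 2 : R) < 1 by lra.
have Ue := chartP ch I12.
have phiC s t x : acting_map Phi s (acting_map Phi t x) =
    acting_map Phi t (acting_map Phi s x).
  by rewrite /acting_map !action_add (@Algebra.addrC S).
have [h hh hphi] := minimal_circle compactX connectedX hausdorffX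
  (@acting_map_continuous X S Phi) phiC minimalPhi ch Ue.
have [cont_h [g [cg hK gK]]] := hh.
have [Psi PsiE] := conjugate_action Phi cont_h cg hK gK.
exists Psi; split.
  move=> s; exists (h (acting_map Phi s (c (1 / 2)))) => z.
  by rewrite PsiE hphi gK.
exists h => // s; apply/funext => x /=.
by rewrite PsiE hK.
Qed.
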